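(* Let $K$ be a field with $\operatorname{char}K\neq 3$ and let $p\geq 2$ be an integer. Let $G$ and $H$ be unital associative $K$-algebras such that $G$ satisfies the identity $[x_1,\dots,x_p]=0$ and $H$ satisfies the identities $[x_1,x_2,x_3]=0$ and $[x_1,x_2][x_3,x_4]=0$. Then: (i) if $p$ is even, then $G\otimes H$ satisfies $[x_1,\dots,x_{p+1}]=0$; (ii) if $p$ is odd, then $G\otimes H$ satisfies $[x_1,\dots,x_{p+2}]=0$.
   Context: $\otimes=\otimes_K$. Long commutators are left-normed: $[u_1,u_2]=u_1u_2-u_2u_1$ and $[u_1,\dots,u_{m+1}]=[[u_1,\dots,u_m],u_{m+1}]$ for $m\ge 2$. An algebra $A$ satisfies the identity $f(x_1,\dots,x_m)=0$, where $f$ is a polynomial in noncommuting variables, if $f(a_1,\dots,a_m)=0$ for all $a_i\in A$. *)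

(* Defs.v *)
From HB Require Import structures.
From mathcomp Require Import all_boot all_algebra generic_quotient.
From mathcomp Require Import boolp classical_sets.

Set Implicit Arguments.
Unset Strict Implicit.
Unset Printing Implicit Defensive.

Import GRing.Theory.

Local Open Scope ring_scope.
Local Open Scope quotient_scope.

(* A finite formal sum of pure tensors g_1 (x) h_1 + ... + g_n (x) h_n is     *)
(* encoded by the sequence of the pairs (g_i, h_i), and [teq] is the least    *)
(* congruence for concatenation that makes the sum commutative and the        *)
(* pairing K-bilinear. No formal scalars are needed: k (g (x) h) is           *)
(* (k g) (x) h.                                                               *)
Inductive teq (K : fieldType) (G H : lmodType K) :
    seq (G * H) -> seq (G * H) -> Prop :=
| teq_refl s : teq s s
| teq_sym s t : teq s t -> teq t s
| teq_trans s t u : teq s t -> teq t u -> teq s u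
| teq_cat s s' t t' : teq s s' -> teq t t' -> teq (s ++ t) (s' ++ t')
| teq_catC s t : teq (s ++ t) (t ++ s)
| teq_0 : teq [:: (0, 0)] [::]
| teq_addl g g' h : teq [:: (g + g', h)] [:: (g, h); (g', h)]
| teq_addr g h h' : teq [:: (g, h + h')] [:: (g, h); (g, h')]
| teq_scale (k : K) g h : teq [:: (k *: g, h)] [:: (g, k *: h)].

Section TensorModule.
Variables (K : fieldType) (G H : lmodType K).
Implicit Types (s t u : seq (G * H)) (k : K).

Definition teqb : rel (seq (G * H)) := fun s t => `[< teq s t >].

Lemma teqb_refl : reflexive teqb.
Proof. by move=> s; apply/asboolP; apply: teq_refl. Qed.

Lemma teqb_sym : symmetric teqb.
Proof. by move=> s t; apply/asboolP/asboolP; apply: teq_sym. Qed.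

Lemma teqb_trans : transitive teqb.
Proof.
move=> t s u /asboolP st /asboolP tu; apply/asboolP; exact: teq_trans st tu.
Qed.

Canonical teq_equiv := EquivRel teqb teqb_refl teqb_sym teqb_trans.

Definition tensor := {eq_quot teq_equiv}.

HB.instance Definition _ := Choice.on tensor.
HB.instance Definition _ := EqQuotient.on tensor.

Definition tcls s : tensor := \pi_tensor s.

Definition tens (g : G) (h : H) : tensor := tcls [:: (g, h)].

Lemma tcls_eq s t : tcls s = tcls t <-> teq s t.
Proof.
split=> [/eqquotP /asboolP //|st]; apply/eqquotP; exact/asboolP.
Qed.

Lemma teq_repr s : teq (repr (tcls s)) s.
Proof. by apply/tcls_eq; rewrite /tcls reprK. Qed.

Lemma tclsP (P : tensor -> Prop) : (forall s, P (tcls s)) -> forall x, P x.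
Proof. by move=> Ps x; rewrite -[x]reprK; apply: Ps. Qed.

Lemma teq_cons x s t : teq s t -> teq (x :: s) (x :: t).
Proof.
by move=> st; apply: (@teq_cat _ _ _ [:: x] [:: x]) => //; apply: teq_refl.
Qed.

Lemma teq_catl s t u : teq s t -> teq (u ++ s) (u ++ t).
Proof. by move=> st; apply: teq_cat => //; apply: teq_refl. Qed.

Lemma teq_catr s t u : teq s t -> teq (s ++ u) (t ++ u).
Proof. by move=> st; apply: teq_cat => //; apply: teq_refl. Qed.

Lemma teq_catACA s t u v : teq ((s ++ t) ++ (u ++ v)) ((s ++ u) ++ (t ++ v)).
Proof.
rewrite -!catA; apply: teq_catl; rewrite !catA; apply: teq_catr.
exact: teq_catC.
Qed.

Lemma teq_0l (h : H) : teq [:: (0 : G, h)] [::].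
Proof.
rewrite -(scale0r (0 : G)); apply: teq_trans (teq_scale _ _ _) _.
by rewrite scale0r; apply: teq_0.
Qed.

Lemma teq_0r (g : G) : teq [:: (g, 0 : H)] [::].
Proof.
rewrite -(scale0r (0 : H)).
apply: teq_trans (teq_sym (teq_scale _ _ _)) _.
by rewrite scale0r; apply: teq_0.
Qed.

Lemma teq_flatten (G' H' : lmodType K) (F : G' * H' -> seq (G * H)) :
    teq (F (0, 0)) [::] ->
    (forall g g' h, teq (F (g + g', h)) (F (g, h) ++ F (g', h))) ->
    (forall g h h', teq (F (g, h + h')) (F (g, h) ++ F (g, h'))) ->
    (forall k g h, teq (F (k *: g, h)) (F (g, k *: h))) ->
  forall s t : seq (G' * H'), teq s t ->
  teq (flatten (map F s)) (flatten (map F t)).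
Proof.
move=> F0 FDl FDr FZ s t; elim=> {s t}.
- by move=> s; apply: teq_refl.
- by move=> s t _; apply: teq_sym.
- by move=> s t u _ st _; apply: teq_trans.
- move=> s s' t t' _ ss' _ tt'.
  by rewrite !map_cat !flatten_cat; apply: teq_cat.
- by move=> s t; rewrite !map_cat !flatten_cat; apply: teq_catC.
- by rewrite /= cats0.
- by move=> g g' h; rewrite /= !cats0.
- by move=> g h h'; rewrite /= !cats0.
- by move=> k g h; rewrite /= !cats0.
Qed.

Definition tscale_seq k s := [seq (k *: x.1, x.2) | x <- s].

Lemma flatten_map1 (T T' : Type) (f : T -> T') (s : seq T) :
  flatten [seq [:: f x] | x <- s] = map f s.
Proof. by elim: s => //= x s ->. Qed.

Lemma teq_scale_seq k s t : teq s t -> teq (tscale_seq k s) (tscale_seq k t).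
Proof.
rewrite /tscale_seq -[map _ s]flatten_map1 -[map _ t]flatten_map1.
apply: teq_flatten => /=.
- by rewrite scaler0; apply: teq_0.
- by move=> g g' h; rewrite scalerDr; apply: teq_addl.
- by move=> g h h'; apply: teq_addr.
- by move=> l g h; rewrite scalerA mulrC -scalerA; apply: teq_scale.
Qed.

Definition tzero : tensor := tcls [::].
Definition tadd (x y : tensor) : tensor := tcls (repr x ++ repr y).
Definition tscale k (x : tensor) : tensor := tcls (tscale_seq k (repr x)).
Definition topp (x : tensor) : tensor := tscale (-1) x.

Lemma tcls_cat s t : tcls (s ++ t) = tadd (tcls s) (tcls t).
Proof. by apply/tcls_eq/teq_sym/teq_cat; apply: teq_repr. Qed.

Lemma tcls_scale k s : tcls (tscale_seq k s) = tscale k (tcls s).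
Proof. by apply/tcls_eq/teq_sym/teq_scale_seq/teq_repr. Qed.

Lemma taddA : associative tadd.
Proof.
elim/tclsP=> s; elim/tclsP=> t; elim/tclsP=> u.
by rewrite -!tcls_cat catA.
Qed.

Lemma taddC : commutative tadd.
Proof.
elim/tclsP=> s; elim/tclsP=> t; rewrite -!tcls_cat.
exact/tcls_eq/teq_catC.
Qed.

Lemma tadd0 : left_id tzero tadd.
Proof. by elim/tclsP=> s; rewrite -tcls_cat. Qed.

Lemma teq_scaleDl k l s :
  teq (tscale_seq (k + l) s) (tscale_seq k s ++ tscale_seq l s).
Proof.
elim: s => [|x s IHs] /=; first exact: teq_refl.
apply: teq_trans (@teq_catACA [:: _] [:: _] _ _).
apply: (@teq_cat _ _ _ [:: _]) => //.
by rewrite scalerDl; apply: teq_addl.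
Qed.

Lemma tscale1 : left_id 1 tscale.
Proof.
elim/tclsP=> s; rewrite -tcls_scale; congr tcls.
by rewrite /tscale_seq -[RHS]map_id; apply: eq_map => -[g h]; rewrite scale1r.
Qed.

Lemma tscaleDl x : {morph tscale^~ x : k l / k + l >-> tadd k l}.
Proof.
elim/tclsP: x => s k l; rewrite -!tcls_scale -tcls_cat.
exact/tcls_eq/teq_scaleDl.
Qed.

Lemma tscale0 x : tscale 0 x = tzero.
Proof.
elim/tclsP: x => s; rewrite -tcls_scale; apply/tcls_eq.
elim: s => [|x s IHs] /=; first exact: teq_refl.
apply: (@teq_cat _ _ _ [:: _] [::]) => //.
by rewrite scale0r; apply: teq_0l.
Qed.

Lemma taddN : left_inverse tzero topp tadd.
Proof.
by move=> x; rewrite /topp -{2}[x]tscale1 -tscaleDl addNr tscale0.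
Qed.

HB.instance Definition _ :=
  GRing.isZmodule.Build tensor taddA taddC tadd0 taddN.

Lemma tscaleA k l x : tscale k (tscale l x) = tscale (k * l) x.
Proof.
elim/tclsP: x => s; rewrite -!tcls_scale; congr tcls.
by rewrite /tscale_seq -map_comp; apply: eq_map => x /=; rewrite scalerA.
Qed.

Lemma tscaleDr : right_distributive tscale +%R.
Proof.
move=> k; elim/tclsP=> s; elim/tclsP=> t.
by rewrite -[_ + _]tcls_cat -!tcls_scale -[RHS]tcls_cat /tscale_seq map_cat.
Qed.

HB.instance Definition _ :=
  GRing.Zmodule_isLmodule.Build K tensor tscaleA tscale1 tscaleDr tscaleDl.

Lemma tcls_sum s : tcls s = \sum_(x <- s) tens x.1 x.2.
Proof.
elim: s => [|[g h] s IHs]; first by rewrite big_nil.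
by rewrite big_cons -IHs -[RHS]tcls_cat.
Qed.

Lemma tensDl g g' h : tens (g + g') h = tens g h + tens g' h.
Proof. by rewrite /tens -[RHS]tcls_cat; apply/tcls_eq/teq_addl. Qed.

Lemma tensDr g h h' : tens g (h + h') = tens g h + tens g h'.
Proof. by rewrite /tens -[RHS]tcls_cat; apply/tcls_eq/teq_addr. Qed.

Lemma tensZl k g h : tens (k *: g) h = k *: tens g h.
Proof. by rewrite -[RHS]tcls_scale. Qed.

Lemma tensZr k g h : tens g (k *: h) = k *: tens g h.
Proof. by rewrite -tensZl; apply/tcls_eq/teq_sym/teq_scale. Qed.

Lemma tensor_sumP (x : tensor) :
  exists s : seq (G * H), x = \sum_(y <- s) tens y.1 y.2.
Proof. by elim/tclsP: x => s; exists s; apply: tcls_sum. Qed.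

Section Universal.
Variables (V : lmodType K) (f : G -> H -> V).
Hypothesis f_linl : forall h, linear (f^~ h).
Hypothesis f_linr : forall g, linear (f g).

Definition tlift (x : tensor) : V := \sum_(y <- repr x) f y.1 y.2.

Let flin0l h : f 0 h = 0.
Proof. by have := f_linl h (-1) 0 0; rewrite scaler0 addr0 scaleN1r addNr. Qed.

Lemma tlift_cls s : tlift (tcls s) = \sum_(y <- s) f y.1 y.2.
Proof.
rewrite /tlift; move: (repr _) (teq_repr s) => r; elim=> {r s} //=.
- by move=> s t u _ -> _ ->.
- by move=> s s' t t' _ ss' _ tt'; rewrite !big_cat /= ss' tt'.
- by move=> s t; rewrite !big_cat /= addrC.
- by rewrite big_nil big_seq1 /= flin0l.
- move=> g g' h; rewrite !big_cons !big_nil !addr0 /=.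
  by have := f_linl h 1 g g'; rewrite !scale1r.
- move=> g h h'; rewrite !big_cons !big_nil !addr0 /=.
  by have := f_linr g 1 h h'; rewrite !scale1r.
- move=> k g h; rewrite !big_seq1 /=.
  have fr0 : f g 0 = 0.
    by have := f_linr g (-1) 0 0; rewrite scaler0 addr0 scaleN1r addNr.
  have := f_linl h k g 0; rewrite flin0l !addr0 => ->.
  by have := f_linr g k h 0; rewrite fr0 !addr0 => ->.
Qed.

Lemma tlift_linear : linear tlift.
Proof.
move=> k; elim/tclsP=> s; elim/tclsP=> t.
rewrite -[k *: _]tcls_scale -[_ + _]tcls_cat !tlift_cls big_cat big_map /=.
rewrite scaler_sumr; congr (_ + _); apply: eq_bigr => y _.
by have := f_linl y.2 k y.1 0; rewrite flin0l !addr0.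
Qed.

HB.instance Definition _ :=
  GRing.isLinear.Build K tensor V *:%R tlift tlift_linear.

Lemma tensor_universal :
  exists2 phi : {linear tensor -> V},
    (forall g h, phi (tens g h) = f g h) &
    (forall psi : {linear tensor -> V},
       (forall g h, psi (tens g h) = f g h) -> psi =1 phi).
Proof.
have liftE g h : tlift (tens g h) = f g h by rewrite tlift_cls big_seq1.
exists tlift => // psi psiE x; have [s ->] := tensor_sumP x.
by rewrite !linear_sum; apply: eq_bigr => y _; rewrite psiE -liftE.
Qed.

End Universal.

End TensorModule.

(* A nonzero vector of an arbitrary vector space is not killed by all linear  *)
(* forms; this is used for 1 != 0 in the tensor product of nonzero algebras.  *)
Lemma linear_form1 (K : fieldType) (V : lmodType K) (v : V) :
  v != 0 -> exists phi : {linear V -> K^o}, phi v = 1.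
Proof.
move=> v0.
pose P (W : set V) :=
  (forall (k : K) x y, W x -> W y -> W (k *: x + y)) /\ ~ W v.
have [|W [[Wlin Wv] Wmax]] := @Zorn_bigcup V P.
  move=> F FP Ftot; split=> [k x y [X FX Xx] [Y FY Yy]|[X FX]]; last first.
    by have [] := FP _ FX.
  have [XY|YX] := Ftot _ _ FX FY.
    by exists Y => //; apply: (FP _ FY).1 => //; apply: XY.
  by exists X => //; apply: (FP _ FX).1 => //; apply: YX.
have Wsub B : P B -> (W `<=` B)%classic -> (B `<=` W)%classic.
  by move=> PB WB; apply: contrapT => BW; apply: (Wmax B).
have W0 : W 0.
  have [[x Wx]|Wn] := pselect (exists x, W x).
    by have := Wlin (-1) _ _ Wx Wx; rewrite scaleN1r addNr.
  apply: (Wsub [set 0%R]%classic) => //.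
    split=> [k x y /= -> ->|/= /eqP]; first by rewrite scaler0 addr0.
    by rewrite (negPf v0).
  by move=> x Wx; case: Wn; exists x.
have WZ k x : W x -> W (k *: x).
  by move=> Wx; have := Wlin k _ _ Wx W0; rewrite addr0.
have WD x y : W x -> W y -> W (x + y).
  by move=> Wx Wy; have := Wlin 1 _ _ Wx Wy; rewrite scale1r.
have ex x : exists k, W (x - k *: v).
  have [|Wx] := pselect (W x); first by exists 0; rewrite scale0r subr0.
  pose B : set V := [set y | exists2 w, W w & exists k, y = w + k *: x]%classic.
  have Bx : B x by exists 0 => //; exists 1; rewrite scale1r add0r.
  have [[w Ww [k vE]]|Bv] := pselect (B v); last first.
    case: Wx; apply: (Wsub B) => //; last first.
      by move=> w Ww; exists w => //; exists 0; rewrite scale0r addr0.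
    split=> // k _ _ [w Ww [l ->]] [w' Ww' [l' ->]].
    exists (k *: w + w'); first exact: Wlin.
    by exists (k * l + l'); rewrite scalerDr scalerA scalerDl addrACA.
  have k0 : k != 0.
    by apply: contra_notN Wv => /eqP k0; rewrite vE k0 scale0r addr0.
  exists k^-1; rewrite vE scalerDr scalerA mulVf // scale1r.
  by rewrite opprD addrCA subrr addr0 -scaleNr; apply: WZ.
have uniq x k l : W (x - k *: v) -> W (x - l *: v) -> k = l.
  move=> Wk Wl; apply/eqP; rewrite -subr_eq0; apply: contraT => kl; case: Wv.
  rewrite -[v]scale1r -(mulVf kl) -scalerA; apply: (WZ).
  have := WD _ _ (WZ (-1) _ Wk) Wl.
  by rewrite scaleN1r opprB addrA subrK scalerBl.
pose phi x : K^o := xget 0 [set k | W (x - k *: v)]%classic.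
have phiW x : W (x - phi x *: v).
  by rewrite /phi; case: xgetP => [k _ //|]; have [k Wk] := ex x => /(_ k).
have phi_lin : linear phi.
  move=> k x y; apply: (uniq _ _ _ (phiW _)).
  have := Wlin k _ _ (phiW x) (phiW y).
  by rewrite scalerBr scalerA addrACA -opprD -scalerDl.
pose phiM := GRing.isLinear.Build K V K^o *:%R phi phi_lin.
pose phiL : {linear V -> K^o} := HB.pack phi phiM.
exists phiL; apply: (uniq v _ _ (phiW v)).
by rewrite scale1r subrr.
Qed.

Section TensorAlgebra.
Variables (K : fieldType) (G H : algType K).
Implicit Types (s t u : seq (G * H)) (k : K).

Definition tmul_seq s t := [seq (x.1 * y.1, x.2 * y.2) | x <- s, y <- t].

Lemma tmul_cons x s t :
  tmul_seq (x :: s) t = [seq (x.1 * y.1, x.2 * y.2) | y <- t] ++ tmul_seq s t.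
Proof. by []. Qed.

Lemma tmul_catl s t u : tmul_seq (s ++ t) u = tmul_seq s u ++ tmul_seq t u.
Proof. by rewrite /tmul_seq map_cat flatten_cat. Qed.

Lemma tmul_catr s t u :
  teq (tmul_seq s (t ++ u)) (tmul_seq s t ++ tmul_seq s u).
Proof.
elim: s => [|x s IHs] /=; first exact: teq_refl.
rewrite !tmul_cons map_cat; apply: teq_trans (teq_catACA _ _ _ _).
exact: teq_catl.
Qed.

Lemma teq_mull s s' t : teq s s' -> teq (tmul_seq s t) (tmul_seq s' t).
Proof.
apply: teq_flatten => /=.
- elim: t => [|y t IHt] /=; first exact: teq_refl.
  by apply: (@teq_cat _ _ _ [:: _] [::]) => //; rewrite !mul0r; apply: teq_0.
- move=> g g' h; elim: t => [|y t IHt] /=; first exact: teq_refl.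
  apply: teq_trans (@teq_catACA _ _ _ [:: _] [:: _] _ _).
  by apply: (@teq_cat _ _ _ [:: _]) => //; rewrite mulrDl; apply: teq_addl.
- move=> g h h'; elim: t => [|y t IHt] /=; first exact: teq_refl.
  apply: teq_trans (@teq_catACA _ _ _ [:: _] [:: _] _ _).
  by apply: (@teq_cat _ _ _ [:: _]) => //; rewrite mulrDl; apply: teq_addr.
- move=> k g h; elim: t => [|y t IHt] /=; first exact: teq_refl.
  apply: (@teq_cat _ _ _ [:: _] [:: _]) => //.
  by rewrite -!scalerAl; apply: teq_scale.
Qed.

Lemma teq_mulr s t t' : teq t t' -> teq (tmul_seq s t) (tmul_seq s t').
Proof.
move=> tt'; elim: s => [|x s IHs]; first exact: teq_refl.
rewrite !tmul_cons; apply: teq_cat => //; move: tt'.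
rewrite -[map _ t]flatten_map1 -[map _ t']flatten_map1.
apply: teq_flatten => /=.
- by rewrite !mulr0; apply: teq_0.
- by move=> g g' h; rewrite mulrDr; apply: teq_addl.
- by move=> g h h'; rewrite mulrDr; apply: teq_addr.
- by move=> k g h; rewrite -!scalerAr; apply: teq_scale.
Qed.

Definition tone : tensor G H := tens 1 1.
Definition tmul (x y : tensor G H) : tensor G H :=
  tcls (tmul_seq (repr x) (repr y)).

Lemma tcls_mul s t : tcls (tmul_seq s t) = tmul (tcls s) (tcls t).
Proof.
apply/tcls_eq/teq_sym; apply: (@teq_trans _ _ _ _ (tmul_seq s (repr (tcls t)))).
  exact/teq_mull/teq_repr.
exact/teq_mulr/teq_repr.
Qed.

Lemma tmulA : associative tmul.
Proof.
elim/tclsP=> s; elim/tclsP=> t; elim/tclsP=> u.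
rewrite -!tcls_mul; congr tcls.
elim: s => [|x s IHs] //; rewrite !tmul_cons tmul_catl IHs; congr (_ ++ _).
elim: t {IHs} => [|y t IHt] //=; rewrite !tmul_cons map_cat IHt; congr (_ ++ _).
by rewrite -map_comp; apply: eq_map => z /=; rewrite !mulrA.
Qed.

Lemma tmul1 : left_id tone tmul.
Proof.
elim/tclsP=> s; rewrite -tcls_mul; congr tcls.
rewrite tmul_cons cats0 -[RHS]map_id.
by apply: eq_map => -[g h] /=; rewrite !mul1r.
Qed.

Lemma tmulr1 : right_id tone tmul.
Proof.
elim/tclsP=> s; rewrite -tcls_mul; congr tcls.
elim: s => [|[g h] s IHs] //.
by rewrite tmul_cons IHs /= !mulr1.
Qed.

Lemma tmulDl : left_distributive tmul +%R.
Proof.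
elim/tclsP=> s; elim/tclsP=> t; elim/tclsP=> u.
by rewrite -[_ + _]tcls_cat -!tcls_mul -[RHS]tcls_cat tmul_catl.
Qed.

Lemma tmulDr : right_distributive tmul +%R.
Proof.
elim/tclsP=> s; elim/tclsP=> t; elim/tclsP=> u.
rewrite -[_ + _]tcls_cat -!tcls_mul -[RHS]tcls_cat.
exact/tcls_eq/tmul_catr.
Qed.

HB.instance Definition _ :=
  GRing.Zmodule_isPzRing.Build (tensor G H) tmulA tmul1 tmulr1 tmulDl tmulDr.

Lemma tensor_oner_neq0 : (1 : tensor G H) != 0.
Proof.
have [phi phi1] := linear_form1 (oner_neq0 G).
pose f (g : G) (h : H) : H := phi g *: h.
have fl h : linear (f^~ h).
  by move=> k x y; rewrite /f linearD linearZ scalerDl scalerA.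
have fr g : linear (f g).
  by move=> k x y; rewrite /f scalerDr !scalerA mulrC.
have [psi psiE _] := tensor_universal fl fr.
apply: contra_neq (oner_neq0 H) => T0.
rewrite -[1]scale1r -phi1 -/(f 1 1) -psiE.
by rewrite -[tens 1 1]/(1 : tensor G H) T0 linear0.
Qed.

HB.instance Definition _ :=
  GRing.PzSemiRing_isNonZero.Build (tensor G H) tensor_oner_neq0.

Lemma tens_mul (g g' : G) (h h' : H) :
  tens g h * tens g' h' = tens (g * g') (h * h').
Proof. by rewrite -[LHS]tcls_mul. Qed.

Lemma tens11 : tens 1 1 = 1 :> tensor G H.
Proof. by []. Qed.

Lemma tensor_scalerAl k (x y : tensor G H) : k *: (x * y) = (k *: x) * y.
Proof.
have [s ->] := tensor_sumP x; have [t ->] := tensor_sumP y.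
rewrite !mulr_suml !scaler_sumr mulr_suml; apply: eq_bigr => a _.
rewrite !mulr_sumr scaler_sumr; apply: eq_bigr => b _.
by rewrite -tensZl !tens_mul -scalerAl tensZl.
Qed.

Lemma tensor_scalerAr k (x y : tensor G H) : k *: (x * y) = x * (k *: y).
Proof.
have [s ->] := tensor_sumP x; have [t ->] := tensor_sumP y.
rewrite !mulr_suml !scaler_sumr; apply: eq_bigr => a _.
rewrite !mulr_sumr scaler_sumr; apply: eq_bigr => b _.
by rewrite -tensZl !tens_mul -scalerAr tensZl.
Qed.

HB.instance Definition _ :=
  GRing.Lmodule_isLalgebra.Build K (tensor G H) tensor_scalerAl.
HB.instance Definition _ :=
  GRing.Lalgebra_isAlgebra.Build K (tensor G H) tensor_scalerAr.

End TensorAlgebra.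

Definition commutator (R : pzRingType) (x y : R) : R := x * y - y * x.

(* lcomm [:: u_1; ...; u_m] is the left-normed [u_1, ..., u_m], for m >= 1;   *)
(* the value 0 at m = 0 is junk.                                              *)
Definition lcomm (R : pzRingType) (s : seq R) : R :=
  foldl (@commutator R) (head 0 s) (behead s).

(* Main.v *)
Require Import Defs.
From mathcomp Require Import all_boot all_algebra.
Set Implicit Arguments.
Unset Strict Implicit.
Unset Printing Implicit Defensive.
Import GRing.Theory.
Local Open Scope ring_scope.

(* Let L_n be the span of the left-normed commutators of length n.  In the    *)
(* presence of 1/3, [L_n A, A] is contained in L_(n+1) for n odd; this is     *)
(* proved by induction on n, in steps of 2, from the fact that the elements   *)
(* [[a, b, c] d, e] are alternating in their five arguments up to             *)
(* commutators of length 4 in a product and three letters, while the sum over *)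
(* the cyclic permutations of b, c, d is such a combination.  Hence, if q is  *)
(* even and L_q = 0, then L_i L_j = 0 whenever i + j = q + 1, one of i and j  *)
(* being odd.  This is applied to G with q = p or q = p + 1.                  *)
(*   On the other side, the ideal of H generated by the commutators is        *)
(* central and annihilated by commutators.  Expanding the commutator of q + 1 *)
(* pure tensors, one is left with w (x) z for z in this ideal and             *)
(* w = [g_j [g_1, ..., g_(j-1)], g_(j+1), ..., g_(q+1)], and by the Leibniz   *)
(* rule w is a sum of products from L_i L_j with i + j = q + 1.               *)

Local Notation "[ ~ x1 , x2 , .. , xn ]" :=
  (commutator .. (commutator x1 x2) .. xn) : ring_scope.

Ltac bring_to_front x :=
  repeat (match goal with
  | |- x + _ = _ => fail 1
  | |- _ => rewrite (addrCA _ x)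
  end).

Ltac ncring :=
  rewrite /commutator; apply/eqP; rewrite -subr_eq0; apply/eqP;
  rewrite ?(mulrDl, mulrDr, mulNr, mulrN, opprD, opprK, mulrA);
  rewrite -[LHS]addr0 -?addrA;
  repeat match goal with
  | |- - ?x + _ = _ => bring_to_front x; rewrite addNKr
  | |- ?x + _ = _ => bring_to_front (- x); rewrite addKr
  end; try reflexivity.

(** * Commutator identities valid in every ring *)

Section Commutator.
Variable R : pzRingType.
Implicit Types (x y z a b c d e : R) (s : seq R).

Lemma commC x y : [~ x, y] = - [~ y, x].
Proof. by rewrite /commutator opprB. Qed.

Lemma commDl x y z : [~ x + y, z] = [~ x, z] + [~ y, z].
Proof. by ncring. Qed.

Lemma comm0l x : [~ 0, x] = 0.
Proof. by rewrite /commutator mul0r mulr0 subrr. Qed.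

Lemma commMl x y z : [~ x * y, z] = x * [~ y, z] + [~ x, z] * y.
Proof. by ncring. Qed.

Lemma commJ x y z : [~ x, [~ y, z]] = [~ x, y, z] - [~ x, z, y].
Proof. by ncring. Qed.

(** When the right side is expanded by Leibniz, the terms starting with [a] cancel by the Jacobi
    identity, and the products of two commutators cancel in pairs. *)
Lemma cyclic_commM a b c d :
  [~ a, c, d] * b + [~ a, d, b] * c + [~ a, b, c] * d =
  [~ a * b, c, d] + [~ a * c, d, b] + [~ a * d, b, c].
Proof. by ncring. Qed.

Lemma commNl x y : [~ - x, y] = - [~ x, y].
Proof. by ncring. Qed.

Lemma commNr x y : [~ x, - y] = - [~ x, y].
Proof. by ncring. Qed.

Lemma commBl x y z : [~ x - y, z] = [~ x, z] - [~ y, z].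
Proof. by rewrite commDl commNl. Qed.

Lemma foldl_commD x y s :
  foldl (@commutator R) (x + y) s =
  foldl (@commutator R) x s + foldl (@commutator R) y s.
Proof. by elim: s x y => //= z s IHs x y; rewrite commDl IHs. Qed.

Lemma foldl_comm0 s : foldl (@commutator R) 0 s = 0.
Proof. by elim: s => //= y s IHs; rewrite comm0l. Qed.

Lemma foldl_comm_sum_eq0 (I : eqType) (r : seq I) (F : I -> R) s :
  (forall i, foldl (@commutator R) (F i) s = 0) ->
  foldl (@commutator R) (\sum_(i <- r) F i) s = 0.
Proof.
move=> F0; elim/big_ind: _ => [|x y x0 y0|i _]; first exact: foldl_comm0.
  by rewrite foldl_commD x0 y0 addr0.
exact: F0.
Qed.

End Commutator.

(** * Alternation of [[[a, b, c] d, e]] modulo [N] *)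

Section TripleProduct.
Variables (R : pzRingType) (N : R -> Prop) (v : R).
Implicit Types a b c d e p q r s t x y : R.
Hypothesis ND : forall x y, N x -> N y -> N (x + y).
Hypothesis NN : forall x, N x -> N (- x).
(* Requiring v among the letters lets an induction use that v is a long       *)
(* commutator.                                                                *)
Hypothesis NM : forall p q r s t, v \in [:: p; q; r; s; t] ->
  N [~ p * q, r, s, t].

Let NB x y : N x -> N y -> N (x - y).
Proof. by move=> Nx Ny; apply/ND/NN. Qed.

(** The digits in [T34], [T45], [T35], [T25] are the positions of two arguments whose exchange
    changes the sign of [T] modulo [N]. *)
Let T a b c d e := [~ [~ a, b, c] * d, e].

Ltac reorder vin :=
  by move: vin; rewrite !inE => /or4P[| | | /orP[|] ] ->; rewrite ?(orTb, orbT).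

Let N5 a b c d e : v \in [:: a; b; c; d; e] ->
  N [~ a, b, c, d, e].
Proof.
move=> vin; have Nab := NM vin.
have Nba : N [~ b * a, c, d, e] by apply: NM; reorder vin.
suff -> : [~ a, b, c, d, e] =
    [~ a * b, c, d, e] - [~ b * a, c, d, e] by apply: NB.
by rewrite -!commBl.
Qed.

(** By Leibniz, [[cd, [b, a]]] is [[a, b, c] d + c [a, b, d]]; moving [c] to the right of
    [[a, b, d]] costs a longer commutator. *)
Let T34 a b c d e : v \in [:: a; b; c; d; e] -> N (T a b c d e + T a b d c e).
Proof.
move=> vin.
suff -> : T a b c d e + T a b d c e = [~ c * d, b, a, e] -
    [~ c * d, a, b, e] + [~ a, b, d, c, e].
  by apply: ND; [apply: NB; apply: NM | apply: N5]; reorder vin.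
rewrite /T -!(commDl, commBl); congr commutator.
by rewrite -commJ (commC b a) commNr; move: [~ a, b] => w; ncring.
Qed.

Let T45 a b c d e : v \in [:: a; b; c; d; e] -> N (T a b c d e + T a b c e d).
Proof.
move=> vin; have -> : T a b c d e + T a b c e d =
    [~ a, b, c, e, d] - [~ d * e, [~ a, b, c]].
  by rewrite /T; move: [~ a, b, c] => w; ncring.
(* Jacobi turns [[de, [a, b, c]]] into a combination of commutators of [de] with three letters. *)
rewrite !commJ commBl.
by apply: NB; [apply: N5|apply: NB; apply: NB; apply: NM]; reorder vin.
Qed.

Let Tcycle a b c d e : v \in [:: a; b; c; d; e] ->
  N (T a c d b e + T a d b c e + T a b c d e).
Proof.
move=> vin; rewrite /T -!commDl cyclic_commM 2!commDl.
by apply: ND; [apply: ND|]; apply: NM; reorder vin.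
Qed.

Let Ntrans x y z : N (x + y) -> N (y + z) -> N (x - z).
Proof. by move=> Nxy Nyz; have := NB Nxy Nyz; rewrite opprD addrA addrK. Qed.

Let T35 a b c d e : v \in [:: a; b; c; d; e] -> N (T a b c d e + T a b e d c).
Proof.
move=> vin.
have cd : N (T a b c d e + T a b d c e) by apply: T34.
have ce : N (T a b d c e + T a b d e c) by apply: T45; reorder vin.
have de : N (T a b d e c + T a b e d c) by apply: T34; reorder vin.
by have := ND (Ntrans cd ce) de; rewrite addrA subrK.
Qed.

(* Exchanging b and e in [Tcycle] changes the sign of two of its three terms, *)
(* hence of the remaining one.                                                *)
Let T25 a b c d e : v \in [:: a; b; c; d; e] -> N (T a b c d e + T a e c d b).
Proof.
move=> vin.
have N1 : N (T a d b c e + T a b c d e + T a c d b e).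
  by apply: Tcycle; reorder vin.
have N2 : N (T a d e c b + T a e c d b + T a c d e b).
  by apply: Tcycle; reorder vin.
have N3 : N (T a d b c e + T a d e c b) by apply: T35; reorder vin.
have N4 : N (T a c d b e + T a c d e b) by apply: T45; reorder vin.
have E x y z x' y' z' :
    x + y + z + (x' + y' + z') - (x + x') - (z + z') = y + y' :> R by ncring.
by have := NB (NB (ND N1 N2) N3) N4; rewrite E.
Qed.

(** A 3-cycle is even: here it is a product of four exchanges. *)
Let T234 a b c d e : v \in [:: a; b; c; d; e] -> N (T a b c d e - T a d b c e).
Proof.
move=> vin.
have N1 : N (T a b c d e + T a b c e d) by apply: T45.
have N2 : N (T a b c e d + T a d c e b) by apply: T25; reorder vin.
have N3 : N (T a d c e b + T a d c b e) by apply: T45; reorder vin.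
have N4 : N (T a d c b e + T a d b c e) by apply: T34; reorder vin.
by have := ND (Ntrans N1 N2) (Ntrans N3 N4); rewrite addrA subrK.
Qed.

(** By [T234] the three terms of [Tcycle] agree modulo [N], so their sum is three times any of
    them. *)
Lemma triple_comm_mul a b c d e : v \in [:: a; b; c; d; e] ->
  N (T a b c d e *+ 3).
Proof.
move=> vin.
have N1 : N (T a b c d e - T a d b c e) by apply: T234.
have N2 : N (T a d b c e - T a c d b e) by apply: T234; reorder vin.
have N3 := Tcycle vin.
have E x y z : z *+ 3 = x + y + z + (z - y) + (z - y) + (y - x) :> R.
  by rewrite mulrS mulr2n; ncring.
by rewrite (E (T a c d b e) (T a d b c e)); apply: (ND (ND (ND N3 N1) N1)).
Qed.

End TripleProduct.

(** * Spans of long commutators, and their products with arbitrary elements *)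

Section LowerCentralSeries.
Variables (K : fieldType) (A : algType K).
Implicit Types (x y z u v w : A) (k : K).

(* Spanned by the left-normed commutators with n brackets, that is, of length *)
(* n + 1.                                                                     *)
Inductive lcs : nat -> A -> Prop :=
| lcs_all x : lcs 0 x
| lcs_comm n x y : lcs n x -> lcs n.+1 [~ x, y]
| lcs_lin n k x y : lcs n x -> lcs n y -> lcs n (k *: x + y).

Lemma lcs0 n : lcs n 0.
Proof.
elim: n => [|n IHn]; first exact: lcs_all.
by rewrite -(comm0l 0); apply: lcs_comm.
Qed.

Lemma lcsD n x y : lcs n x -> lcs n y -> lcs n (x + y).
Proof. by move=> nx ny; rewrite -[x]scale1r; apply: lcs_lin. Qed.

Lemma lcsZ n k x : lcs n x -> lcs n (k *: x).
Proof. by move=> nx; rewrite -[_ *: _]addr0; apply/lcs_lin/lcs0. Qed.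

Lemma lcsN n x : lcs n x -> lcs n (- x).
Proof. by move=> nx; rewrite -scaleN1r; apply: lcsZ. Qed.

Lemma lcsB n x y : lcs n x -> lcs n y -> lcs n (x - y).
Proof. by move=> nx ny; apply/lcsD/lcsN. Qed.

Lemma commZl k x y : [~ k *: x, y] = k *: [~ x, y].
Proof. by rewrite /commutator -scalerAl -scalerAr scalerBr. Qed.

Lemma lcsS_ind n (P : A -> Prop) :
    (forall x y, lcs n x -> P [~ x, y]) ->
    (forall k x y, P x -> P y -> P (k *: x + y)) ->
  forall x, lcs n.+1 x -> P x.
Proof.
move=> Pcomm Plin x; move mE: n.+1 => m mx.
elim: mx mE => // {m x} [m x y mx _ [mE]|m k x y _ IHx _ IHy mE].
  by apply: Pcomm; rewrite mE.
by apply: Plin; [apply: IHx|apply: IHy].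
Qed.

Lemma lcs_mono n x : lcs n.+1 x -> lcs n x.
Proof.
elim: n x => [|n IHn]; first by move=> x _; apply: lcs_all.
apply: lcsS_ind => [x y nx|k x y]; [exact/lcs_comm/IHn|exact: lcs_lin].
Qed.

Lemma lcs_commr n z m x : lcs n x -> lcs m z -> lcs (n + m).+1 [~ z, x].
Proof.
move=> nx mz; elim: nx m z mz => {n x}.
- by move=> x m z mz; apply: lcs_comm.
- move=> n x y _ IHx m z mz; rewrite commJ; apply: lcsB.
    exact/lcs_comm/IHx.
  by rewrite addSnnS; apply/IHx/lcs_comm.
- move=> n k x y _ IHx _ IHy m z mz.
  by rewrite commC commDl commZl opprD -scalerN -!(commC z); apply: lcs_lin;
     [apply: IHx|apply: IHy].
Qed.

Lemma foldl_commZ k x s :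
  foldl (@commutator A) (k *: x) s = k *: foldl (@commutator A) x s.
Proof. by elim: s x => //= y s IHs x; rewrite commZl IHs. Qed.

Lemma foldl_comm_lcs p n x s :
    (forall y t, size t = p -> foldl (@commutator A) y t = 0) ->
  lcs n x -> (n + size s)%N = p -> foldl (@commutator A) x s = 0.
Proof.
move=> idA nx; elim: nx s => {n x} [x|n x y _ IHx|n k x y _ IHx _ IHy] s nE.
- exact: idA.
- by apply: (IHx (y :: s)); rewrite /= addnS -nE.
- by rewrite foldl_commD foldl_commZ IHx // IHy // scaler0 addr0.
Qed.

Hypothesis char3 : 3%:R != 0 :> K.

Lemma lcs_mul_comm n v x y : ~~ odd n -> lcs n v -> lcs n.+1 [~ v * x, y].
Proof.
elim/ltn_ind: n v x y => -[|[|n]] // IHn u x y n_even.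
  by move=> _; apply/lcs_comm/lcs_all.
move: u; apply: lcsS_ind => [u b|k u v Pu Pv]; last first.
  rewrite mulrDl -scalerAl commDl commZl; exact: lcs_lin.
move: u; apply: lcsS_ind => [v a nv|k u v Pu Pv]; last first.
  rewrite commDl commZl mulrDl -scalerAl commDl commZl; exact: lcs_lin.
  have vM q r : lcs n.+1 [~ v * q, r].
    by apply: IHn => //; rewrite negbK in n_even.
  have Mv q r : lcs n.+1 [~ q * v, r].
    rewrite (_ : q * v = v * q - [~ v, q]); last by ncring.
    rewrite commBl; apply/lcsB/lcs_mono => //.
    exact/lcs_comm/lcs_comm.
  suff: lcs n.+3 ([~ [~ v, a, b] * x, y] *+ 3).
    move/(lcsZ 3%:R^-1); rewrite -scaler_nat scalerA mulVf // scale1r //.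
  (* [N] is [lcs n.+3]. If [v] is in the product [p * q], the induction hypothesis gives [n.+1] and
     two brackets remain; if [v] is one of the three letters, [lcs_commr] or antisymmetry
     suffices. *)
  apply: (@triple_comm_mul _ _ v).
  + exact: lcsD.
  + exact: lcsN.
  + move=> p q r s t; rewrite !inE => /or4P[| | | /orP[|] ] /eqP vE; subst.
    * exact/lcs_comm/lcs_comm/vM.
    * exact/lcs_comm/lcs_comm/Mv.
    * by apply/lcs_comm/lcs_comm; rewrite commC; apply/lcsN/lcs_comm.
    * have := lcs_commr nv (lcs_comm r (lcs_all (p * q))).
      by rewrite addn1 => /lcs_comm.
    * have := lcs_commr nv (lcs_comm s (lcs_comm r (lcs_all (p * q)))).
      by rewrite addn2.
  + by rewrite inE eqxx.
Qed.

Lemma lcs_mul_commr n m v x w :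
  ~~ odd n -> lcs n v -> lcs m w -> lcs (n + m).+1 [~ v * x, w].
Proof.
move=> n_even nv mw; elim: mw x => {m w}.
- by move=> w x; rewrite addn0; apply: lcs_mul_comm.
- move=> m y z my IHm x; rewrite commJ; apply: lcsB.
    by rewrite addnS; apply/lcs_comm/IHm.
  by rewrite addnS -addSn addnC; apply/lcs_commr/lcs_mul_comm.
- move=> m k y z _ IHy _ IHz x.
  by rewrite commC commDl commZl opprD -scalerN -!(commC (v * x));
     apply: lcs_lin; [apply: IHy|apply: IHz].
Qed.

(** * Vanishing of products when [lcs m] is zero, [m] odd *)

Variable m : nat.
Hypothesis m_odd : odd m.
Hypothesis lcs_vanish : forall x, lcs m x -> x = 0.

Lemma lcs_mul_eq0_even a b x y :
  ~~ odd a -> (a + b)%N = m -> lcs a x -> lcs b y -> x * y = 0.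
Proof.
move=> a_even; case: b => [|b] abE ax.
  by move: a_even; rewrite -[a]addn0 abE m_odd.
move: y; apply: lcsS_ind => [w z bw|k u v xu xv]; last first.
  by rewrite mulrDr -scalerAr xu xv scaler0 addr0.
have H1 : [~ x * z, w] = 0.
  by apply: lcs_vanish; rewrite -abE addnS; apply: lcs_mul_commr.
have H2 : [~ w, x] = 0.
  by apply: lcs_vanish; rewrite -abE addnS; apply: lcs_commr.
have -> : x * [~ w, z] = - [~ x * z, w] - [~ w, x] * z by ncring.
by rewrite H1 H2 mul0r oppr0 addr0.
Qed.

Lemma lcs_mul_eq0 a b x y : (a + b)%N = m -> lcs a x -> lcs b y -> x * y = 0.
Proof.
move=> abE ax bx; have [a_odd|a_even] := boolP (odd a); last first.
  exact: lcs_mul_eq0_even abE ax bx.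
have b_even : ~~ odd b by move: m_odd; rewrite -abE oddD a_odd.
have xyC : [~ x, y] = 0.
  by apply/lcs_vanish/lcs_mono; rewrite -abE addnC; apply: lcs_commr.
(* The factors commute, so the one with even index can be put first. *)
rewrite -[LHS](subrK (y * x)) -/[~ x, y] xyC add0r.
by apply: lcs_mul_eq0_even b_even _ bx ax; rewrite addnC.
Qed.

(** By Leibniz each bracket raises [a] or [b] by one, until the indices add up to [m]. *)
Lemma foldl_comm_mul a b x y s :
  lcs a x -> lcs b y -> (a + b + size s)%N = m ->
  foldl (@commutator A) (x * y) s = 0.
Proof.
elim: s a b x y => [|z s IHs] a b x y ax by_ /=.
  by rewrite addn0 => abE; apply: lcs_mul_eq0 abE _ _.
rewrite addnS => abE; rewrite commMl foldl_commD.
by rewrite (IHs a b.+1) ?(IHs a.+1 b) ?addr0 ?addnS ?addSn //; apply: lcs_comm.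
Qed.

End LowerCentralSeries.

(** * Commutators of pure tensors *)

Section TensorCommutator.
Variables (K : fieldType) (G H : algType K).
Implicit Types (g u w : G) (h z : H).
Hypothesis idH3 : forall x1 x2 x3 : H, lcomm [:: x1; x2; x3] = 0.
Hypothesis idH22 :
  forall x1 x2 x3 x4 : H, lcomm [:: x1; x2] * lcomm [:: x3; x4] = 0.

(* These z form a central ideal of H that contains all commutators. *)
Definition central_annihilator z :=
  (forall h, z * h = h * z) /\ (forall h h', z * [~ h, h'] = 0).

Lemma central_annihilator_comm h h' : central_annihilator [~ h, h'].
Proof.
split=> [k|k k']; last exact: idH22.
by apply/eqP; rewrite -subr_eq0; apply/eqP; apply: (idH3 h h' k).
Qed.

Lemma central_annihilatorM z h :
  central_annihilator z -> central_annihilator (z * h).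
Proof.
move=> [zC z0]; split=> [k|k k'].
  rewrite -mulrA -[h * k](subrK (k * h)) mulrDr -/[~ h, k] z0 add0r.
  by rewrite !mulrA zC.
by rewrite zC -mulrA z0 mulr0.
Qed.

Lemma tens0l h : tens (0 : G) h = 0.
Proof. by rewrite -(scale0r 0) tensZl scale0r. Qed.

Lemma tensNl g h : tens (- g) h = - tens g h.
Proof. by rewrite -scaleN1r tensZl scaleN1r. Qed.

Lemma tensNr g h : tens g (- h) = - tens g h.
Proof. by rewrite -scaleN1r tensZr scaleN1r. Qed.

Lemma comm_tens g g' h h' :
  [~ tens g h, tens g' h'] =
    tens [~ g, g'] (h * h') + tens (g' * g) [~ h, h'].
Proof.
rewrite {1}/commutator !tens_mul /commutator tensDl tensNl tensDr tensNr.
by rewrite addrA subrK.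
Qed.

Lemma comm_sumr (x : tensor G H) (r : seq (G * H)) (F : G * H -> tensor G H) :
  [~ x, \sum_(i <- r) F i] = \sum_(i <- r) [~ x, F i].
Proof. by rewrite /commutator mulr_sumr mulr_suml -sumrB. Qed.

Lemma foldl_comm_tens_annihilator w z (s : seq (tensor G H)) :
    central_annihilator z ->
    (forall t : seq G, size t = size s -> foldl (@commutator G) w t = 0) ->
  foldl (@commutator (tensor G H)) (tens w z) s = 0.
Proof.
elim: s w z => [|y s IHs] w z zI w0 /=.
  by have /= -> := w0 [::] erefl; apply: tens0l.
have [r ->] := tensor_sumP y; rewrite comm_sumr.
apply: foldl_comm_sum_eq0 => -[g h] /=.
rewrite comm_tens [[~ z, h]](_ : _ = 0); last by rewrite /commutator zI.1 subrr.
rewrite -(scale0r 0) tensZr scale0r addr0.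
apply: IHs => [|t tE]; first exact: central_annihilatorM.
by apply: (w0 (g :: t)); rewrite /= tE.
Qed.

Variable m : nat.
Hypothesis char3 : 3%:R != 0 :> K.
Hypothesis m_odd : odd m.
Hypothesis lcs_vanish : forall g, lcs m g -> g = 0.

(** In [comm_tens] the first term lengthens the commutator [u], while the second has a central
    annihilator in [H], so that later brackets act on the factor in [G] only. *)
Lemma foldl_comm_tens n u h (s : seq (tensor G H)) :
  lcs n u -> (n + size s)%N = m.+1 ->
  foldl (@commutator (tensor G H)) (tens u h) s = 0.
Proof.
elim: s n u h => [|y s IHs] n u h nu /=.
  rewrite addn0 => nE; move: nu; rewrite nE => /lcs_mono /lcs_vanish ->.
  exact: tens0l.
rewrite addnS => -[nE]; have [r ->] := tensor_sumP y; rewrite comm_sumr.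
apply: foldl_comm_sum_eq0 => -[g k] /=.
rewrite comm_tens foldl_commD (IHs n.+1) ?addSn ?nE //; last exact: lcs_comm.
rewrite add0r; apply: foldl_comm_tens_annihilator => [|t tE].
  exact: central_annihilator_comm.
by apply: (foldl_comm_mul char3 m_odd lcs_vanish (lcs_all g) nu); rewrite tE.
Qed.

Lemma lcomm_tensor_eq0 (x : m.+2.-tuple (tensor G H)) : lcomm x = 0.
Proof.
case: x => -[|y s] //= /eqP [sE]; rewrite /lcomm /=.
have [r ->] := tensor_sumP y; apply: foldl_comm_sum_eq0 => -[g h].
exact: (foldl_comm_tens _ (lcs_all g)).
Qed.

End TensorCommutator.

Theorem proposition2p8 (K : fieldType) (charK : 3%N \notin [pchar K])
    (p : nat) (p_ge2 : (2 <= p)%N) (G H : algType K)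
    (idG : forall x : p.-tuple G, lcomm x = 0)
    (idH3 : forall x1 x2 x3 : H, lcomm [:: x1; x2; x3] = 0)
    (idH22 : forall x1 x2 x3 x4 : H, lcomm [:: x1; x2] * lcomm [:: x3; x4] = 0) :
  (~~ odd p -> forall x : p.+1.-tuple (tensor G H), lcomm x = 0) /\
  (odd p -> forall x : p.+2.-tuple (tensor G H), lcomm x = 0).
Proof.
have char3 : 3%:R != 0 :> K by move: charK; rewrite inE.
case: p p_ge2 idG => // p _ idG.
have G0 (g : G) : lcs p g -> g = 0.
  move=> pg; apply: (foldl_comm_lcs (s := [::]) _ pg); last exact: addn0.
  move=> x s /eqP sE; have xsE : size (x :: s) == p.+1 by [].
  exact: (idG (Tuple xsE)).
(* After the [case], the identity of [G] has length [p.+1], that is, [p] brackets. The odd [m] is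
   [p] in the first part and [p.+1] in the second. *)
split=> /= p_odd x.
  by apply: lcomm_tensor_eq0 x => //; rewrite -[odd p]negbK.
by apply: lcomm_tensor_eq0 x => // g /lcs_mono; apply: G0.
Qed.
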